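(* Let $\Gamma$ be a genuine strongly $\ell$-walk-regular graph (for some integer $\ell\ge2$) of valency $k$ with distinct adjacency eigenvalues $k>\theta_1>\theta_2>\theta_3$. If $\frac{2\theta_i}{k}$ is an algebraic integer for every $i\in\{1,2,3\}$, then $(\theta_1,\theta_2,\theta_3)=(\frac{k}{2},0,-\frac{k}{2})$.
   Context: Graphs are finite and simple. Let $A$ be the adjacency matrix and $J$ the all-ones matrix. For an integer $\ell\ge2$, a graph is strongly $\ell$-walk-regular if $A^\ell$ is a linear combination of $I$, $A$ and $J$. A genuine strongly $\ell$-walk-regular graph is a connected regular strongly $\ell$-walk-regular graph whose adjacency matrix has exactly four distinct eigenvalues. A complex number is an algebraic integer if it is a root of a monic polynomial with integer coefficients. *)

(* Defs.v *)
From HB Require Import structures.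
From mathcomp Require Import all_boot all_order all_algebra all_field.
Set Implicit Arguments.
Unset Strict Implicit.
Unset Printing Implicit Defensive.
Import Order.TTheory GRing.Theory Num.Theory.
Local Open Scope ring_scope.

Record sgraph := SGraph {
  vertex :> finType;
  edge : rel vertex;
  edge_sym : symmetric edge;
  edge_irrefl : irreflexive edge
}.

Definition connected_graph (G : sgraph) : Prop :=
  forall x y : G, connect (@edge G) x y.

Definition regular_graph (G : sgraph) (k : nat) : Prop :=
  forall x : G, #|[set y | edge x y]| = k.

(* Over algC, which contains all the (algebraic) eigenvalues of an integer
   matrix. *)
Definition adjmx (G : sgraph) : 'M[algC]_#|G| :=
  \matrix_(i, j) (edge (enum_val i) (enum_val j))%:R.

Definition strongly_walk_regular (l : nat) (G : sgraph) : Prop :=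
  (2 <= l)%N /\
  exists a b c : algC,
    adjmx G ^+ l = a%:M + b *: adjmx G + c *: const_mx 1.

Definition distinct_eigenvalues (n : nat) (A : 'M[algC]_n) (s : seq algC) :
    Prop :=
  uniq s /\ eigenvalue A =i s.

Definition genuine_swr (l : nat) (G : sgraph) : Prop :=
  [/\ connected_graph G,
      exists k, regular_graph G k,
      strongly_walk_regular l G &
      exists2 s, distinct_eigenvalues (adjmx G) s & size s = 4%N].

Definition algebraic_integer (z : algC) : Prop :=
  integralOver (intr : int -> algC) z.

(* Main.v *)
Require Import Defs.
From HB Require Import structures.
From mathcomp Require Import all_boot all_order all_algebra all_field.
From mathcomp Require Import spectral sesquilinear.
From mathcomp Require Import zify ring lra.
Set Implicit Arguments.
Unset Strict Implicit.
Unset Printing Implicit Defensive.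
Import Order.TTheory GRing.Theory Num.Theory.
Local Open Scope ring_scope.

(** Put x_i = 2 theta_i / k.  Eigenvectors for theta_i are orthogonal to the
    all-ones vector, so theta_i^l = a + b theta_i: the points (x_i, x_i^l) are
    collinear.  By convexity this forces e1 = x_1 + x_2 + x_3 to lie between 0
    and x_2.  The elementary symmetric functions of the x_i are rational
    algebraic integers, hence integers, and |x_i| <= 2; then e1 = 0, because
    for e1 = 1 the integer (x_1 - 1)(x_2 - 1)(x_3 - 1) would lie strictly
    between -1 and 0 (and symmetrically for e1 = -1).  So the x_i are the roots
    of an integer cubic x^3 - c x - e, and the bound on the x_i and positivity
    of the discriminant leave x^3 - x, x^3 - 2x, x^3 - 3x, x^3 - 2x -+ 1 and
    x^3 - 3x -+ 1.  All but the first contradict tr A = 0, tr A^2 = n k with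
    integer multiplicities: irrational conjugate roots must have equal
    multiplicities, and for x^3 - 2x -+ 1 the valency would satisfy
    2 < k < 3. *)

(** * Collinear points on the graph of a power *)

(** Convexity of the power, cleared of denominators. The gap for [l.+1] is [z] times the gap for [l]
    plus [(z - y) * (z - x) * (y ^+ l - x ^+ l)]. *)
Lemma pow_chord_ge0 (R : realFieldType) (l : nat) (x y z : R) :
  0 <= x -> x < y -> y < z ->
  (z - x) * y ^+ l <= (z - y) * x ^+ l + (y - x) * z ^+ l.
Proof.
move=> x0 xy yz; elim: l => [|l IH]; first by rewrite !expr0; lra.
have xyl : x ^+ l <= y ^+ l by rewrite lerXn2r ?nnegrE //; lra.
have := mulr_ge0 (mulr_ge0 (_ : 0 <= z - y) (_ : 0 <= z - x))
  (_ : 0 <= y ^+ l - x ^+ l).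
have : z * ((z - x) * y ^+ l) <= z * ((z - y) * x ^+ l + (y - x) * z ^+ l).
  by rewrite ler_wpM2l //; lra.
rewrite !subr_ge0 !exprS => + /(_ (ltW yz) (ltW (lt_trans xy yz)) xyl); lra.
Qed.

(** One step of the same recurrence, whose extra term is strictly positive because the exponent in
    it is at least 1. *)
Lemma pow_chord_gt0 (R : realFieldType) (l : nat) (x y z : R) :
  (2 <= l)%N -> 0 <= x -> x < y -> y < z ->
  (z - x) * y ^+ l < (z - y) * x ^+ l + (y - x) * z ^+ l.
Proof.
case: l => [//|[//|l]] _ x0 xy yz.
have IH := pow_chord_ge0 l.+1 x0 xy yz.
have xyl : x ^+ l.+1 < y ^+ l.+1 by rewrite ltrXn2r ?nnegrE //; lra.
rewrite !(exprS _ l.+1).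
have : 0 < (z - y) * (z - x) * (y ^+ l.+1 - x ^+ l.+1).
  by rewrite !mulr_gt0 ?subr_gt0 //; lra.
have : z * ((z - x) * y ^+ l.+1)
    <= z * ((z - y) * x ^+ l.+1 + (y - x) * z ^+ l.+1).
  by rewrite ler_wpM2l //; lra.
lra.
Qed.

(** For odd [n = l.+3], this places the graph of [t ^+ n] at [-(x + z)] on or below the chord
    through [x] and [z]. It is an equality for [l = 0]; the induction multiplies by [x + z] and
    drops two nonnegative terms. *)
Lemma pow_sum_ge (R : realFieldType) (l : nat) (x z : R) :
  0 <= x -> x < z ->
  (x + z) * (z ^+ l.+3 - x ^+ l.+3) + x * z * (z ^+ l.+2 - x ^+ l.+2)
    <= (z - x) * (x + z) ^+ l.+3.
Proof.
move=> x0 xz; elim: l => [|l IH]; first by rewrite !exprS !expr0; lra.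
have H0 n : x ^+ n <= z ^+ n by rewrite lerXn2r ?nnegrE //; lra.
have H2 := H0 l.+2; have H1 := H0 l.+1; have z0 : 0 < z by lra.
have : (x + z) * ((x + z) * (z ^+ l.+3 - x ^+ l.+3)
   + x * z * (z ^+ l.+2 - x ^+ l.+2)) <= (x + z) * ((z - x) * (x + z) ^+ l.+3).
  by rewrite ler_wpM2l //; lra.
have : 0 <= x * z * ((x + z) * (z ^+ l.+2 - x ^+ l.+2)).
  by rewrite !mulr_ge0 ?subr_ge0 //; lra.
have : 0 <= x * z * (x * z) * (z ^+ l.+1 - x ^+ l.+1).
  by rewrite !mulr_ge0 ?subr_ge0 //; lra.
rewrite !(exprS _ l.+3) !(exprS _ l.+2) !(exprS _ l.+1).
move: (z ^+ l.+1) (x ^+ l.+1) ((x + z) ^+ l.+1) => u v w; lra.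
Qed.

(* The equation says that the points (x_i, x_i^l) are collinear. *)
Lemma pow_collinear_ge0 (R : realFieldType) (l : nat) (x1 x2 x3 : R) :
  (2 <= l)%N -> x3 < x2 -> x2 < x1 -> 0 <= x2 ->
  (x1 - x2) * x3 ^+ l + (x2 - x3) * x1 ^+ l = (x1 - x3) * x2 ^+ l ->
  0 <= x1 + x2 + x3 /\ (x1 + x2 + x3 < x2 \/ x2 = 0 /\ x1 + x2 + x3 = 0).
Proof.
move=> l2 x32 x21 x20 E.
have [x3ge0|x3lt0] := leP 0 x3.
  by have := pow_chord_gt0 l2 x3ge0 x32 x21; lra.
have [y Dy] : exists y, x3 = - y by exists (- x3); rewrite opprK.
subst x3; have y0 : 0 < y by lra.
have powlt n : x2 ^+ n.+1 < x1 ^+ n.+1 by rewrite ltrXn2r ?nnegrE //; lra.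
rewrite exprNn -signr_odd in E; case odd_l: (odd l) E; last first.
  (* Even powers are strictly convex on the whole line, so both positions of [y] relative to [x2]
     are contradictory. *)
  rewrite /= expr0 mul1r => E.
  have lt21 : x2 ^+ l < x1 ^+ l by case: (l) l2.
  have [yx|xy] := ltP y x2.
    have := pow_chord_gt0 l2 (ltW y0) yx x21.
    have : 0 < y * (x1 ^+ l - x2 ^+ l) by rewrite mulr_gt0 ?subr_gt0.
    lra.
  have : x2 ^+ l <= y ^+ l by rewrite lerXn2r ?nnegrE //; lra.
  have : 0 < (x2 + y) * (x1 ^+ l - x2 ^+ l) by rewrite mulr_gt0 ?subr_gt0 //; lra.
  nra.
case: l l2 odd_l => [|[|[|l]]] // _ _; rewrite expr1 mulN1r => E.
have Delta : x2 * x1 ^+ l.+3 - x1 * x2 ^+ l.+3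
    = x1 * x2 * (x1 ^+ l.+2 - x2 ^+ l.+2) by rewrite !(exprS _ l.+2); ring.
have powD : 0 < x1 ^+ l.+2 - x2 ^+ l.+2 by rewrite subr_gt0.
(* If [y > x1], the sum is below [x2] at once, and [pow_sum_ge] rules out [y > x1 + x2]. If
   [y <= x1], collinearity leaves only the triple [x1, 0, -x1]. *)
have [yle|ylt] := leP y x1; last first.
  split; last by left; lra.
  rewrite leNgt; apply/negP => ygt.
  have := pow_sum_ge l x20 x21; set w := x2 + x1 => Q.
  have w0 : 0 < w by rewrite /w; lra.
  have yw : w ^+ l.+2 < y ^+ l.+2 by rewrite ltrXn2r ?nnegrE /w //; lra.
  have : 0 < (x1 - x2) * y * w * (y ^+ l.+2 - w ^+ l.+2).
    by rewrite !mulr_gt0 // subr_gt0.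
  have : 0 <= (y - w) * (x1 * x2 * (x1 ^+ l.+2 - x2 ^+ l.+2)).
    by rewrite !mulr_ge0 ?(ltW powD) //; rewrite ?/w; lra.
  have : w * ((x1 - x2) * (y * y ^+ l.+2))
      = w * (y * (x1 ^+ l.+3 - x2 ^+ l.+3)
             + x1 * x2 * (x1 ^+ l.+2 - x2 ^+ l.+2)).
    by rewrite -Delta -exprS; congr (_ * _); lra.
  move: Q; rewrite [w ^+ l.+3]exprS -(ler_pM2l y0).
  lra.
have yl : y ^+ l.+2 <= x1 ^+ l.+2 by rewrite lerXn2r ?nnegrE //; lra.
have x2_0 : x2 = 0.
  apply/eqP; rewrite eq_le x20 andbT leNgt; apply/negP => x2gt.
  have : 0 < x2 * (y + x1) * (x1 ^+ l.+2 - x2 ^+ l.+2).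
    by rewrite !mulr_gt0 //; lra.
  have : 0 <= (x1 - x2) * y * (x1 ^+ l.+2 - y ^+ l.+2).
    by rewrite !mulr_ge0 //; lra.
  move: E; rewrite !(exprS _ l.+2); lra.
have y_x1 : y = x1.
  apply/eqP; rewrite eq_le yle leNgt; apply/negP => yx1.
  have : 0 < x1 * y * (x1 ^+ l.+2 - y ^+ l.+2).
    by rewrite !mulr_gt0 ?subr_gt0 ?ltrXn2r ?nnegrE //; lra.
  move: E; rewrite x2_0 !(exprS _ l.+2); lra.
by split; [lra | right; split; lra].
Qed.

Lemma pow_collinear_sum0_nonneg (R : realFieldType) (l : nat)
    (x1 x2 x3 : R) (e1 e2 e3 : int) :
  (2 <= l)%N -> x3 < x2 -> x2 < x1 -> 0 <= x2 -> x1 <= 2 -> -2 <= x3 ->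
  (x1 - x2) * x3 ^+ l + (x2 - x3) * x1 ^+ l = (x1 - x3) * x2 ^+ l ->
  x1 + x2 + x3 = e1%:~R -> x1 * x2 + x1 * x3 + x2 * x3 = e2%:~R ->
  x1 * x2 * x3 = e3%:~R ->
  e1 = 0.
Proof.
move=> l2 x32 x21 x20 x1le x3ge E s1 s2 s3.
have [] := pow_collinear_ge0 l2 x32 x21 x20 E.
rewrite s1 ler0z => e1_ge0 [e1lt|[_ /eqP]]; last by rewrite intr_eq0 => /eqP.
have e1_lt2 : e1%:~R < (2%:Z)%:~R :> R by lra.
rewrite ltr_int in e1_lt2.
have [//|e1_1] : e1 = 0 \/ e1 = 1 by lia.
rewrite {}e1_1 {e1_ge0 e1_lt2} in s1 e1lt.
(* Minus the value at 1 of the monic cubic with roots x_i, taken with e1 = 1. *)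
have : (x1 - 1) * (x2 - 1) * (x3 - 1) = (e3 - e2)%:~R.
  rewrite rmorphB /= -s2 -s3; move: s1; rewrite /= => s1.
  have -> : x3 = 1 - x1 - x2 by lra.
  by ring.
have y1 : 0 < x1 - 1 by lra.
have y2 : 0 < x2 - 1 by lra.
have y3 : x3 - 1 = - (2 + (x1 - 1) + (x2 - 1)) by lra.
have y12 : (x1 - 1) + (x2 - 1) <= 1 by lra.
(* The product is now [- u * v * (2 + u + v)]; since [u + v <= 1] gives u v <= 1/4, it is at least
   -3/4. *)
rewrite y3; move: (x1 - 1) (x2 - 1) y1 y2 y12 => u v u0 v0 uv P.
have uv0 : 0 < u * v by rewrite mulr_gt0.
have : (e3 - e2)%:~R < 0%:~R :> R by rewrite -P; nra.
have : (-1)%:~R < (e3 - e2)%:~R :> R.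
  rewrite -P; have : 0 <= (u - v) ^+ 2 by rewrite sqr_ge0.
  have : 0 <= (1 - (u + v)) * (1 + (u + v)) by rewrite mulr_ge0 //; lra.
  have : 0 <= (1 - (u + v)) * (u * v) by rewrite !mulr_ge0 //; lra.
  rewrite !expr2; lra.
rewrite !ltr_int; lia.
Qed.

Lemma pow_collinear_sum0 (R : realFieldType) (l : nat)
    (x1 x2 x3 : R) (e1 e2 e3 : int) :
  (2 <= l)%N -> x3 < x2 -> x2 < x1 -> x1 <= 2 -> -2 <= x3 ->
  (x1 - x2) * x3 ^+ l + (x2 - x3) * x1 ^+ l = (x1 - x3) * x2 ^+ l ->
  x1 + x2 + x3 = e1%:~R -> x1 * x2 + x1 * x3 + x2 * x3 = e2%:~R ->
  x1 * x2 * x3 = e3%:~R ->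
  e1 = 0.
Proof.
move=> l2 x32 x21 x1le x3ge E s1 s2 s3.
have [x20|x20] := leP 0 x2.
  exact: (pow_collinear_sum0_nonneg l2 x32 x21 x20 x1le x3ge E s1 s2 s3).
(* For [x2 < 0], the triple [- x3, - x2, - x1] is in the previous case: e1 and e3 change sign, and
   the collinearity equation is multiplied by (-1)^l. *)
apply: oppr_inj; rewrite oppr0.
have EN : (- x3 - - x2) * (- x1) ^+ l + (- x2 - - x1) * (- x3) ^+ l
    = (- x3 - - x1) * (- x2) ^+ l.
  rewrite (exprNn x1) (exprNn x2) (exprNn x3).
  transitivity ((-1) ^+ l * ((x1 - x2) * x3 ^+ l + (x2 - x3) * x1 ^+ l)).
    by ring.
  by rewrite E; ring.
clear E; apply: (@pow_collinear_sum0_nonneg R l (- x3) (- x2) (- x1)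
  (- e1) e2 (- e3) l2 _ _ _ _ _ EN); rewrite ?rmorphN /= -?s1 -?s2 -?s3; lra.
Qed.

(** * Integer cubics with small roots *)

(** Rational root theorem, by way of [algC], where a rational algebraic integer is an integer. *)
Lemma rat_root_depressed_cubic (c e : int) (t : rat) :
  t ^+ 3 = c%:~R * t + e%:~R -> exists2 z : int, t = z%:~R & z ^+ 3 = c * z + e.
Proof.
move=> rt; suff /intrP[z Dz] : t \in Num.int.
  exists z => //; apply/eqP; rewrite -(eqr_int rat) rmorphD rmorphM rmorphXn /=.
  by rewrite -Dz rt.
have : (ratr t : algC) \in Num.int; last first.
  by move=> /intrP[z /eqP]; rewrite -ratr_int (inj_eq (fmorph_inj _)) => /eqP->.
apply: Cint_rat_Aint; first exact: Crat_rat.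
have : (ratr t : algC) ^+ 3 = c%:~R * ratr t + e%:~R.
  by rewrite -rmorphXn rt rmorphD rmorphM !rmorph_int.
move: (ratr t) => x rx.
pose p : {poly algC} := 'X^3 - (c%:~R *: 'X + e%:~R%:P).
have sz : (size (- (c%:~R *: 'X + e%:~R%:P) : {poly algC})
    < size ('X^3 : {poly algC}))%N.
  rewrite size_polyN size_polyXn (leq_ltn_trans (size_polyD _ _)) // gtn_max.
  rewrite (leq_ltn_trans (size_scale_leq _ _)) ?size_polyX //.
  by rewrite (leq_ltn_trans (size_polyC_leq1 _)).
apply: (@root_monic_Aint p); rewrite /p.
- by rewrite /root /p !hornerE rx subrr.
- by rewrite monicE lead_coefDl // lead_coefXn.
- apply/polyOverP=> i; rewrite !(coefD, coefN, coefZ, coefXn, coefX, coefC).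
  by rewrite rpredB ?rpredD ?rpredM ?rpred_nat ?intr_int //;
    case: ifP; rewrite ?rpred0 ?intr_int.
Qed.

(** Used on trace relations: unequal multiplicities give a nonzero coefficient [v], which makes the
    root rational. *)
Lemma linear_root_depressed_cubic (R : realFieldType) (c e u v : int) (x : R) :
  x ^+ 3 = c%:~R * x + e%:~R -> v != 0 -> v%:~R * x = u%:~R ->
  exists2 z : int, x = z%:~R & z ^+ 3 = c * z + e.
Proof.
move=> rx v0 vx.
have [q Dx] : exists q : rat, x = ratr q.
  exists (u%:~R / v%:~R); rewrite fmorph_div !rmorph_int -vx mulrAC.
  by rewrite divff ?mul1r // intr_eq0.
have [|z Dz zP] := @rat_root_depressed_cubic c e q.
  apply: (fmorph_inj (ratr : rat -> R)).
  by rewrite rmorphXn rmorphD rmorphM !rmorph_int; rewrite Dx in rx.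
by exists z; rewrite // Dx Dz rmorph_int.
Qed.

(** z^3 - 3 z is always even. *)
Lemma no_int_root_cubic3 (z e : int) : z ^+ 3 = 3 * z + e -> e = 1 \/ e = -1 -> False.
Proof.
have [y [->|->]] : exists y, z = 2 * y \/ z = 2 * y + 1.
  by exists (z %/ 2)%Z; lia.
all: rewrite !exprS expr0; nia.
Qed.

(** The second equation makes [y] a root of the cubic divided by X - x. Eliminating [y] would leave
    [x] a root of an integer quadratic, impossible for a cubic without rational roots. *)
Lemma irred_cubic_rel (R : realFieldType) (e u v w : int) (x y : R) :
  x ^+ 3 = 3 * x + e%:~R -> x ^+ 2 + x * y + y ^+ 2 = 3 ->
  e = 1 \/ e = -1 -> u%:~R * x + v%:~R * y = w%:~R -> u = 0 /\ v = 0.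
Proof.
move=> rx q e1 lin.
have rx' : x ^+ 3 = (3 : int)%:~R * x + e%:~R by [].
have [v0|v_neq0] := eqVneq v 0.
  split=> //; apply/eqP; apply/negPn/negP => u0.
  have [|z _ /no_int_root_cubic3] := linear_root_depressed_cubic rx' u0 (u := w);
    last by apply.
  by rewrite -lin v0 mul0r addr0.
pose al := u ^+ 2 - u * v + v ^+ 2.
pose be := v * w - 2 * u * w.
pose ga := w ^+ 2 - 3 * v ^+ 2.
(* Multiply x^2 + x y + y^2 = 3 by v^2 and substitute v y = w - u x. The leading coefficient [al] is
   a positive definite form in [u] and [v]. *)
have quad : al%:~R * x ^+ 2 + be%:~R * x + ga%:~R = 0.
  have -> : ga%:~R = w%:~R ^+ 2 - 3 * v%:~R ^+ 2 :> R.
    by rewrite /ga rmorphB !(rmorphXn, rmorphM).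
  rewrite /al /be !(rmorphD, rmorphN, rmorphM, rmorphXn) /= -lin -q; ring.
have al0 : al != 0 by rewrite /al; nia.
clearbody al be ga.
(* Reduce al x^3 modulo the quadratic relation; if the coefficient below
   vanishes, be / al is a rational root of the cubic. *)
have key : (3 * al ^+ 2 - be ^+ 2 + al * ga)%:~R * x
    = (be * ga - al ^+ 2 * e)%:~R.
  rewrite !(rmorphD, rmorphN, rmorphM, rmorphXn) /=.
  have Dga : ga%:~R = - (al%:~R * x ^+ 2 + be%:~R * x) by lra.
  have De : e%:~R = x ^+ 3 - 3 * x by lra.
  rewrite Dga De; ring.
have [co0|co0] := eqVneq (3 * al ^+ 2 - be ^+ 2 + al * ga) 0; last first.
  by have [z _ /no_int_root_cubic3 /(_ e1)] := linear_root_depressed_cubic rx' co0 key.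
move: key; rewrite co0 mul0r => /esym/eqP; rewrite intr_eq0 => /eqP cst0.
have alQ : al%:~R != 0 :> rat by rewrite intr_eq0.
have [|z _ /no_int_root_cubic3] := @rat_root_depressed_cubic 3 e (be%:~R / al%:~R);
  last by move=> /(_ e1).
have E : be ^+ 3 = 3 * be * al ^+ 2 + e * al ^+ 3.
  apply/eqP; rewrite -subr_eq0; apply/eqP.
  transitivity (- be * (3 * al ^+ 2 - be ^+ 2 + al * ga)
    + al * (be * ga - al ^+ 2 * e)); first by ring.
  by rewrite co0 cst0; ring.
have : (be ^+ 3)%:~R = (3 * be * al ^+ 2 + e * al ^+ 3)%:~R :> rat by rewrite E.
rewrite !(rmorphXn, rmorphD, rmorphM) /= => EQ.
by rewrite expr_div_n EQ; field.
Qed.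

(* The last two equations are tr A = 0 and tr A^2 = n k, rescaled by 2 / k,
   with multiplicities m0 of k and m_i of theta_i. *)
Lemma small_cubic_roots (R : realFieldType) (x1 x2 x3 : R) (c e : int)
    (m0 m1 m2 m3 k : nat) :
  x3 < x2 -> x2 < x1 -> x1 < 2 -> -2 <= x3 ->
  x1 + x2 + x3 = 0 -> x1 * x2 + x1 * x3 + x2 * x3 = - c%:~R ->
  x1 * x2 * x3 = e%:~R ->
  (0 < m0)%N -> (0 < m1)%N -> (0 < m2)%N -> (0 < m3)%N ->
  m0%:R * 2 + m1%:R * x1 + m2%:R * x2 + m3%:R * x3 = 0 ->
  k%:R * (m0%:R * 4 + m1%:R * x1 ^+ 2 + m2%:R * x2 ^+ 2 + m3%:R * x3 ^+ 2)
    = 4 * (m0%:R + m1%:R + m2%:R + m3%:R) ->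
  [/\ x1 = 1, x2 = 0 & x3 = -1].
Proof.
move=> x32 x21 x1lt x3ge s1 s2 s3 m0p m1p m2p m3p tr1 tr2.
have Dx3 : x3 = - x1 - x2 by lra.
have x1p : 0 < x1 by lra.
have x3n : x3 < 0 by lra.
have Dc : c%:~R = x1 ^+ 2 + x1 * x2 + x2 ^+ 2.
  by apply: oppr_inj; rewrite -s2 Dx3; ring.
(* [c] equals both x1^2 - x2 x3 and x3^2 - x1 x2; the sign of [x2] selects the form whose subtracted
   product is positive. At [x2 = 0] strictness comes from [x1 < 2]. *)
have c_lt : c%:~R < (4%:Z)%:~R :> R.
  have x1sq : 0 < (2 - x1) * (2 + x1) by rewrite mulr_gt0; lra.
  have x3sq : 0 <= (2 - x3) * (2 + x3) by rewrite mulr_ge0; lra.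
  have [x20|x20] := leP 0 x2; last first.
    have := nmulr_rgt0 x3 x20; rewrite x3n Dx3 in x3sq * => ?.
    rewrite Dc /=; lra.
  have [x2_0|x2_neq0] := eqVneq x2 0.
    by rewrite Dc x2_0 /=; lra.
  have : 0 < x1 * x2 by rewrite mulr_gt0 // lt_def x2_neq0.
  by rewrite Dx3 in x3sq; rewrite Dc /=; lra.
have c_gt : 0%:~R < c%:~R :> R.
  rewrite Dc /=; have := mulr_gt0 x1p x1p.
  by have := sqr_ge0 (x1 + 2 * x2); lra.
have disc : (27 * e ^+ 2)%:~R < (4 * c ^+ 3)%:~R :> R.
  rewrite -subr_gt0 -rmorphB !(rmorphB, rmorphM, rmorphXn) /= -s3 Dc Dx3.
  have -> : 4 * (x1 ^+ 2 + x1 * x2 + x2 ^+ 2) ^+ 3 -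
    27 * (x1 * x2 * (- x1 - x2)) ^+ 2 =
    ((x1 - x2) * (x1 - (- x1 - x2)) * (x2 - (- x1 - x2))) ^+ 2 by ring.
  by rewrite exprn_gt0 // !mulr_gt0 //; lra.
rewrite !ltr_int in c_lt c_gt disc.
have cub x : (x - x1) * (x - x2) * (x - x3) = x ^+ 3 - c%:~R * x - e%:~R.
  by rewrite -s3 Dc Dx3; ring.
have r1 : x1 ^+ 3 = c%:~R * x1 + e%:~R by have := cub x1; lra.
have r2 : x2 ^+ 3 = c%:~R * x2 + e%:~R by have := cub x2; lra.
(* 27 e^2 < 4 c^3 is at most 4, 32 or 108 for c = 1, 2, 3. *)
have e_case : e = 0 \/ (c = 2 \/ c = 3) /\ (e = 1 \/ e = -1).
  have : c = 1 \/ c = 2 \/ c = 3 by lia.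
  by case=> [c1|[c1|c1]]; rewrite c1 in disc *; nia.
have m0R : 0 < m0%:R :> R by rewrite ltr0n.
case: e_case => [e0|[[c2|c3] e1]].
- have x2_0 : x2 = 0.
    move: s3; rewrite e0 => /eqP; rewrite !mulf_eq0 => /orP[/orP[]|] /eqP; lra.
  have x3_x1 : x3 = - x1 by lra.
  have c_x1 : c%:~R = x1 ^+ 2 by rewrite Dc x2_0; ring.
  have [c1|c_ne1] := eqVneq c 1.
    move: c_x1; rewrite c1 x3_x1 x2_0 => c_x1.
    have : (x1 - 1) * (x1 + 1) = 0 by rewrite /= in c_x1; lra.
    by move/eqP; rewrite mulf_eq0 => /orP[] /eqP ?; split=> //; lra.
  (* Equal multiplicities for [x1] and [- x1] would reduce the trace relation to 2 m0 = 0. Unequal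
     ones force [x1] to be the integer 1, hence [c = 1]. *)
  have d0 : (m3%:Z - m1%:Z) != 0.
    apply/eqP => d0; have m13 : m3 = m1 by lia.
    by move: tr1; rewrite m13 x2_0 x3_x1; lra.
  have [|z Dz z3] := linear_root_depressed_cubic r1 d0 (u := 2 * m0%:Z).
    rewrite rmorphM rmorphB /= -!pmulrn; move: tr1; rewrite x2_0 x3_x1; lra.
  move: x1p x1lt; rewrite Dz ltr0z (ltr_int R _ 2) => z0 z2.
  have z1 : z = 1 by lia.
  by move: z3; rewrite z1 e0 expr1n; lia.
- have [e_1|e_1] := e1. (* x^3 - 2x - e = (x + e) (x^2 - e x - 1) *)
    have x3_N1 : x3 = -1.
      have : (-1 - x1) * (-1 - x2) * (-1 - x3) = 0.
        by rewrite cub c2 e_1 /=; ring.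
      by move/eqP; rewrite !mulf_eq0 => /orP[/orP[]|] /eqP; lra.
    have x2E : x2 = 1 - x1 by lra.
    have sq : x1 ^+ 2 = x1 + 1 by move: Dc; rewrite c2 x2E /=; lra.
    have [d0|d0] := eqVneq (m1%:Z - m2%:Z) 0; last first.
      have [|z Dz z3] := linear_root_depressed_cubic r1 d0
        (u := m3%:Z - m2%:Z - 2 * m0%:Z).
        rewrite !(rmorphM, rmorphB) /= -!pmulrn; move: tr1.
        by rewrite x2E x3_N1; lra.
      move: x1p x1lt; rewrite Dz ltr0z (ltr_int R _ 2) => z0 z2.
      have z1 : z = 1 by lia.
      by move: z3; rewrite z1 e_1 c2 expr1n; lia.
    have m12 : m1 = m2 by lia.
    have m3E : m3 = (m2 + 2 * m0)%N.
      apply/eqP; rewrite -(eqr_nat R) natrD natrM; apply/eqP.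
      by move: tr1; rewrite m12 x2E x3_N1; lra.
    have : (k * (m0 * 4 + 3 * m2 + m3) = 4 * (m0 + 2 * m2 + m3))%N.
      apply/eqP; rewrite -(eqr_nat R) !(natrD, natrM); apply/eqP.
      have -> : 4%:R * (m0%:R + 2%:R * m2%:R + m3%:R) =
        4 * (m0%:R + m1%:R + m2%:R + m3%:R) :> R by rewrite m12; ring.
      rewrite -tr2 m12 x2E x3_N1; congr (_ * _).
      have -> : (1 - x1) ^+ 2 = 3 - (x1 + 1) by rewrite sqrrB sq; ring.
      by rewrite sq; ring.
    (* The equation is now k (6 m0 + 4 m2) = 12 (m0 + m2), so 2 < k < 3. *)
    rewrite m3E; case: k {tr2} => [|[|[|k]]]; nia.
  (* For e = -1 the integer root is 1 and the irrational pair is [x2, x3]. The final equation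
     becomes k (10 m0 + 4 m1) = 20 m0 + 12 m1, and again 2 < k < 3. *)
  have x1_1 : x1 = 1.
    have : (1 - x1) * (1 - x2) * (1 - x3) = 0.
      by rewrite cub c2 e_1 /=; ring.
    by move/eqP; rewrite !mulf_eq0 => /orP[/orP[]|] /eqP; lra.
  have x3E : x3 = -1 - x2 by lra.
  have sq : x2 ^+ 2 = 1 - x2 by move: Dc; rewrite c2 x1_1 /=; lra.
  have [d0|d0] := eqVneq (m2%:Z - m3%:Z) 0; last first.
    have [|z Dz z3] := linear_root_depressed_cubic r2 d0
      (u := m3%:Z - m1%:Z - 2 * m0%:Z).
      rewrite !(rmorphM, rmorphB) /= -!pmulrn; move: tr1.
      by rewrite x1_1 x3E; lra.
    have z_lt : z%:~R < (1%:Z)%:~R :> R by rewrite -Dz /=; lra.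
    have z_gt : (-2)%:~R < z%:~R :> R by rewrite -Dz; lra.
    rewrite !ltr_int in z_lt z_gt.
    move: z3; rewrite e_1 c2.
    by have [->|->] : z = 0 \/ z = -1 by lia.
  have m23 : m2 = m3 by lia.
  have m3E : m3 = (m1 + 2 * m0)%N.
    apply/eqP; rewrite -(eqr_nat R) natrD natrM; apply/eqP.
    by move: tr1; rewrite m23 x1_1 x3E; lra.
  have : (k * (m0 * 4 + 3 * m3 + m1) = 4 * (m0 + 2 * m3 + m1))%N.
    apply/eqP; rewrite -(eqr_nat R) !(natrD, natrM); apply/eqP.
    have -> : 4%:R * (m0%:R + 2%:R * m3%:R + m1%:R) =
      4 * (m0%:R + m1%:R + m2%:R + m3%:R) :> R by rewrite m23; ring.
    rewrite -tr2 m23 x1_1 x3E; congr (_ * _).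
    have -> : (-1 - x2) ^+ 2 = 1 + 2 * x2 + x2 ^+ 2 by ring.
    by rewrite sq; ring.
  rewrite m3E; case: k {tr2} => [|[|[|k]]]; nia.
(* With x3 = -x1 - x2, the trace relation is an integer relation between 1, [x1] and [x2]. Hence m1
   = m2 = m3, and the relation collapses to 2 m0 = 0. *)
- rewrite c3 in r1 Dc.
  have [] := @irred_cubic_rel R e (m1%:Z - m3%:Z) (m2%:Z - m3%:Z) (- 2 * m0%:Z)
    x1 x2 r1 (esym Dc) e1.
    rewrite !(rmorphM, rmorphB, rmorphN) /= -!pmulrn; move: tr1; rewrite Dx3; lra.
  move=> d13 d23; have m13 : m1 = m3 by lia.
  have m23 : m2 = m3 by lia.
  move: tr1; rewrite m13 m23 Dx3; lra.
Qed.

(** * Spectrum of a regular graph *)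

Lemma adjmx_tr (G : sgraph) : (adjmx G)^T = adjmx G.
Proof. by apply/matrixP => i j; rewrite !mxE edge_sym. Qed.

Lemma adjmx_row_sum (G : sgraph) (k : nat) (i : 'I_#|G|) :
  regular_graph G k -> \sum_j adjmx G i j = k%:R.
Proof.
move=> regG; transitivity (\sum_(x : G) (edge (enum_val i) x)%:R : algC).
  rewrite (reindex (fun j : 'I_#|G| => enum_val j)) /=.
    by apply: eq_bigr => j _; rewrite mxE.
  exact/onW_bij/enum_val_bij.
rewrite -(regG (enum_val i)) -sum1_card natr_sum [RHS]big_mkcond /=.
by apply: eq_bigr => x _; rewrite inE; case: edge.
Qed.

Lemma adjmx_mul_const (G : sgraph) (k p : nat) : regular_graph G k ->
  adjmx G *m (const_mx 1 : 'M_(_, p)) = k%:R *: const_mx 1.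
Proof.
move=> regG; apply/matrixP => i j; rewrite !mxE mulr1 -(adjmx_row_sum i regG).
by apply: eq_bigr => h _; rewrite !mxE mulr1.
Qed.

Lemma mxtrace_adjmx (G : sgraph) : \tr (adjmx G) = 0.
Proof. by rewrite /mxtrace big1 // => i _; rewrite mxE edge_irrefl. Qed.

Lemma mxtrace_adjmx_sqr (G : sgraph) (k : nat) : regular_graph G k ->
  \tr (adjmx G *m adjmx G) = #|G|%:R * k%:R.
Proof.
move=> regG; rewrite /mxtrace.
rewrite (eq_bigr (fun=> k%:R)) ?sumr_const ?card_ord ?mulr_natl // => i _.
rewrite mxE -(adjmx_row_sum i regG); apply: eq_bigr => j _.
by rewrite -{2}adjmx_tr !mxE; case: edge; rewrite ?mulr0 ?mulr1.
Qed.

(** Associating v A J in two ways gives (t - k) v J = 0, so the J term vanishes when the identity is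
    applied to an eigenvector [v]. *)
Lemma adjmx_eigenvalue_pow (G : sgraph) (l k : nat) (a b c t : algC) :
  regular_graph G k -> adjmx G ^+ l = a%:M + b *: adjmx G + c *: const_mx 1 ->
  eigenvalue (adjmx G) t -> t != k%:R -> t ^+ l = a + b * t.
Proof.
move=> regG eqA /eigenvalueP[v vA v0] tk.
have vJ : v *m (const_mx 1 : 'M_#|G|) = 0.
  have : (t - k%:R) *: (v *m (const_mx 1 : 'M_#|G|)) = 0.
    rewrite scalerBl scalemxAl -vA -mulmxA (adjmx_mul_const _ regG).
    by rewrite -scalemxAr subrr.
  by move/eqP; rewrite scaler_eq0 subr_eq0 (negPf tk) => /eqP.
have vAl m : v *m adjmx G ^+ m = t ^+ m *: v.
  elim: m => [|m IH]; first by rewrite !expr0 scale1r mulmx1.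
  by rewrite exprSr -[_ * _]/(_ *m _) mulmxA IH -scalemxAl vA scalerA -exprSr.
have := vAl l; rewrite eqA !mulmxDr mul_mx_scalar -!scalemxAr vA vJ scaler0 addr0.
rewrite scalerA -scalerDl => /eqP.
rewrite -subr_eq0 -scalerBl scaler_eq0 (negPf v0) orbF subr_eq0.
by move/eqP.
Qed.

(** Compare the l1 norms of t v and v A by the triangle inequality; every row of A sums to k. *)
Lemma adjmx_eigenvalue_le (G : sgraph) (k : nat) (t : algC) :
  regular_graph G k -> eigenvalue (adjmx G) t -> `|t| <= k%:R.
Proof.
move=> regG /eigenvalueP[v vA v0].
have norm0 : 0 < \sum_i `|v 0 i|.
  rewrite lt_def sumr_ge0 // andbT; apply: contraNneq v0 => sum0.
  apply/eqP/rowP => i; rewrite mxE; apply/eqP; rewrite -normr_eq0; apply/eqP.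
  by apply: (psumr_eq0P _ sum0).
rewrite -(ler_pM2r norm0) mulr_sumr.
have -> : k%:R * \sum_i `|v 0 i| = \sum_j \sum_i `|v 0 i * adjmx G i j|.
  rewrite exchange_big mulr_sumr; apply: eq_bigr => i _.
  rewrite -(adjmx_row_sum i regG) mulr_suml; apply: eq_bigr => j _.
  by rewrite normrM mulrC [X in _ * `|X|]mxE normr_nat mxE.
apply: ler_sum => j _; rewrite -normrM.
have -> : t * v 0 j = \sum_i v 0 i * adjmx G i j.
  by move/rowP/(_ j): vA; rewrite !mxE.
exact: ler_norm_sum.
Qed.

(** * Diagonalisation, multiplicities and rationality *)

Lemma adjmx_spectral (G : sgraph) :
  exists P : 'M[algC]_#|G|, exists d : 'rV[algC]_#|G|,
    P \in unitmx /\ adjmx G = invmx P *m diag_mx d *m P.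
Proof.
have /orthomx_spectralP A_eq : adjmx G \is normalmx.
  apply: symmetric_normalmx.
    by apply/is_hermitianmxP; rewrite expr0 scale1r map_mx_id ?adjmx_tr.
  by apply/mxOverP => i j; rewrite mxE.
exists (spectralmx (adjmx G)), (spectral_diag (adjmx G)).
by split=> //; exact: spectral_unit.
Qed.

Lemma eigenvalue_diag (F : fieldType) (n : nat) (A P : 'M[F]_n) (d : 'rV_n) (a : F) :
  P \in unitmx -> A = invmx P *m diag_mx d *m P ->
  eigenvalue A a = [exists i, d 0 i == a].
Proof.
move=> Pu ->; apply/eigenvalueP/existsP => [[v vA v0] | [i /eqP <-]]; last first.
  exists (row i P).
    rewrite -!row_mul !mulmxA mulmxV // mul1mx row_mul.
    by apply/rowP => j; rewrite row_diag_mx -scalemxAl -rowE.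
  apply/eqP => ri0; have := congr1 (row i) (mulmxV Pu).
  rewrite row_mul ri0 mul0mx => /rowP/(_ i)/eqP.
  by rewrite !mxE eqxx eq_sym oner_eq0.
pose w := v *m invmx P.
have w0 : w != 0.
  by apply: contraNneq v0 => w0; rewrite -[v](mulmxKV Pu) -/w w0 mul0mx.
have [i wi] := rV0Pn _ w0; exists i.
have : w *m diag_mx d = a *: w.
  by rewrite /w scalemxAl -vA !mulmxA mulmxK.
clearbody w; move/rowP/(_ i); rewrite mul_mx_diag !mxE mulrC => dw.
by apply/eqP; apply: (mulIf wi); rewrite dw.
Qed.

Lemma mxminpoly_of_diag (F : fieldType) (n : nat) (A P : 'M[F]_n.+1) (d : 'rV_n.+1) :
  P \in unitmx -> A = invmx P *m diag_mx d *m P ->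
  mxminpoly A = \prod_(z <- undup [seq d 0 i | i <- enum 'I_n.+1]) ('X - z%:P).
Proof.
move=> Pu DA; rewrite -mxminpoly_diag -(mxminpoly_uconj A Pu).
suff -> : conjmx P A = diag_mx d by [].
rewrite (conjumx _ Pu) {}DA; move: (diag_mx d) => D.
by rewrite !mulmxA (mulmxV Pu) mul1mx (mulmxK Pu).
Qed.

(** For a diagonalisable matrix this product is the minimal polynomial, which is unchanged by field
    extension and so comes from the rational matrix. *)
Lemma prod_eigenvalues_rat (n : nat) (M : 'M[rat]_n) (A P : 'M[algC]_n)
    (d : 'rV_n) (s : seq algC) :
  A = map_mx ratr M -> P \in unitmx -> A = invmx P *m diag_mx d *m P ->
  uniq s -> eigenvalue A =i s ->
  exists q : {poly rat}, \prod_(z <- s) ('X - z%:P) = map_poly ratr q.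
Proof.
move=> AM Pu Ad us eigA.
have memd z : (z \in s) = [exists i, d 0 i == z].
  by rewrite -eigA; exact: (eigenvalue_diag z Pu Ad).
(* [mxminpoly] is for positive sizes; in size 0 the list [s] is empty. *)
case: n => [|n] in M A P d AM Pu Ad eigA memd *.
  exists 1; rewrite rmorph1 big_seq big1 // => z; rewrite memd.
  by case/existsP => -[].
exists (mxminpoly M); rewrite -mxminpoly_map -AM (mxminpoly_of_diag Pu Ad).
apply: perm_big; rewrite uniq_perm ?undup_uniq // => z; rewrite mem_undup memd.
apply/existsP/mapP => [[i /eqP <-]|[i _ ->]]; exists i => //.
by rewrite mem_enum.
Qed.

(** Taking [f] to be the identity, the square and the constant 1 gives tr A, tr A^2 and the order in
    terms of multiplicities. *)
Lemma sum_diag_eigenvalues (n : nat) (d : 'rV[algC]_n) (s : seq algC)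
    (f : algC -> algC) :
  uniq s -> (forall i, d 0 i \in s) ->
  \sum_i f (d 0 i) = \sum_(z <- s) #|[set i | d 0 i == z]|%:R * f z.
Proof.
move=> us ds.
transitivity (\sum_i \sum_(z <- s | z == d 0 i) f z).
  apply: eq_bigr => i _; rewrite big_mkcond (bigD1_seq (d 0 i)) //= eqxx.
  by rewrite big1 ?addr0 // => z /negPf->.
rewrite (exchange_big_dep predT) //=; apply: eq_bigr => z _.
rewrite sumr_const mulr_natl; congr (_ *+ _); apply: eq_card => i.
by rewrite inE unfold_in /= eq_sym.
Qed.

Lemma mxtrace_diag_form (n : nat) (A P : 'M[algC]_n) (d : 'rV_n) :
  P \in unitmx -> A = invmx P *m diag_mx d *m P ->
  \tr A = \sum_i d 0 i /\ \tr (A *m A) = \sum_i d 0 i ^+ 2.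
Proof.
move=> Pu ->; split.
  by rewrite mxtrace_mulC mulmxA (mulmxV Pu) mul1mx mxtrace_diag.
rewrite -!mulmxA mxtrace_mulC !mulmxA !(mulmxK Pu) mulmx_diag mxtrace_diag.
by apply: eq_bigr => i _; rewrite mxE.
Qed.

Lemma coef_prod4 (F : comNzRingType) (a b c d : F) :
  let p := \prod_(z <- [:: a; b; c; d]) ('X - z%:P) in
  [/\ p`_3 = - (a + b + c + d),
      p`_2 = a * b + a * c + a * d + b * c + b * d + c * d &
      p`_1 = - (a * b * c + a * b * d + a * c * d + b * c * d)].
Proof.
rewrite /= !big_cons big_nil mulr1.
have coefXB z (q : {poly F}) i :
    (('X - z%:P) * q)`_i.+1 = q`_i - z * q`_i.+1.
  by rewrite mulrBl coefB coefXM coefCM.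
have coefXB0 z (q : {poly F}) : (('X - z%:P) * q)`_0 = - (z * q`_0).
  by rewrite mulrBl coefB coefXM coefCM sub0r.
rewrite !(coefXB, coefXB0) !coefB !coefX !coefC /=; split; ring.
Qed.

(** * Integrality, transfer to a real field, and conclusion *)

Lemma algebraic_integer_Aint (z : algC) : algebraic_integer z -> z \in Aint.
Proof.
case=> p mon_p rp; apply: root_monic_Aint rp _ _; first exact: monic_map.
by apply/polyOverP => i; rewrite coef_map intr_int.
Qed.

Lemma Crat_Aint_intr (z : algC) :
  z \in Crat -> z \in Aint -> exists e : int, z = e%:~R.
Proof. by move=> zQ zI; apply/intrP/Cint_rat_Aint. Qed.

(** Order arguments above need a totally ordered field. The x_i are comparable with 2, hence real,
    so everything is transported to [algR]. *)
Lemma scaled_spectrum_eq (l k : nat) (x1 x2 x3 : algC) (e1 e2 e3 : int)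
    (m0 m1 m2 m3 : nat) :
  (2 <= l)%N -> x3 < x2 -> x2 < x1 -> x1 < 2 -> -2 <= x3 ->
  (x1 - x2) * x3 ^+ l + (x2 - x3) * x1 ^+ l = (x1 - x3) * x2 ^+ l ->
  x1 + x2 + x3 = e1%:~R -> x1 * x2 + x1 * x3 + x2 * x3 = e2%:~R ->
  x1 * x2 * x3 = e3%:~R ->
  (0 < m0)%N -> (0 < m1)%N -> (0 < m2)%N -> (0 < m3)%N ->
  m0%:R * 2 + m1%:R * x1 + m2%:R * x2 + m3%:R * x3 = 0 ->
  k%:R * (m0%:R * 4 + m1%:R * x1 ^+ 2 + m2%:R * x2 ^+ 2 + m3%:R * x3 ^+ 2)
    = 4 * (m0%:R + m1%:R + m2%:R + m3%:R) ->
  [/\ x1 = 1, x2 = 0 & x3 = -1].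
Proof.
move=> l2 x32 x21 x1lt x3ge E s1 s2 s3 m0p m1p m2p m3p tr1 tr2.
have R1 : x1 \is Num.real by rewrite (ler_real (ltW x1lt)) realn.
have R2 : x2 \is Num.real by rewrite (ler_real (ltW x21)).
have R3 : x3 \is Num.real by rewrite (ler_real (ltW x32)).
pose y1 := in_algR R1; pose y2 := in_algR R2; pose y3 := in_algR R3.
have y1lt : y1 < 2 by [].
have y3ge : -2 <= y3 by [].
have y21 : y2 < y1 by [].
have y32 : y3 < y2 by [].
have EY : (y1 - y2) * y3 ^+ l + (y2 - y3) * y1 ^+ l = (y1 - y3) * y2 ^+ l.
  by apply: val_inj; rewrite /= !(rmorphD, rmorphM, rmorphXn).
have S1 : y1 + y2 + y3 = e1%:~R by apply: val_inj; rewrite rmorph_int.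
have S2 : y1 * y2 + y1 * y3 + y2 * y3 = e2%:~R.
  by apply: val_inj; rewrite rmorph_int.
have S3 : y1 * y2 * y3 = e3%:~R by apply: val_inj; rewrite rmorph_int.
have e1_0 := pow_collinear_sum0 l2 y32 y21 (ltW y1lt) y3ge EY S1 S2 S3.
have [] := @small_cubic_roots algR y1 y2 y3 (- e2) e3 m0 m1 m2 m3 k.
all: rewrite ?rmorphN ?opprK //.
- by rewrite S1 e1_0.
- by apply: val_inj; rewrite !(rmorphD, rmorphM, rmorph_nat) rmorph0.
- by apply: val_inj; rewrite !(rmorphD, rmorphM, rmorphXn, rmorph_nat).
by move=> /(congr1 val) ? /(congr1 val) ? /(congr1 val) ?; split.
Qed.

Theorem theorem4p12 (G : sgraph) (l k : nat) (theta1 theta2 theta3 : algC)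
    (genG : genuine_swr l G) (valG : regular_graph G k)
    (eigG : distinct_eigenvalues (adjmx G) [:: k%:R; theta1; theta2; theta3])
    (lt1 : theta1 < k%:R) (lt2 : theta2 < theta1) (lt3 : theta3 < theta2)
    (int1 : algebraic_integer (2%:R * theta1 / k%:R))
    (int2 : algebraic_integer (2%:R * theta2 / k%:R))
    (int3 : algebraic_integer (2%:R * theta3 / k%:R)) :
  (theta1, theta2, theta3) = (k%:R / 2%:R, 0, - (k%:R / 2%:R)).
Proof.
have [_ _ [l2 [a [b [c eqA]]]] _] := genG; have [us eigA] := eigG.
have eigE z : eigenvalue (adjmx G) z = (z \in [:: k%:R; theta1; theta2; theta3])
  := eigA z.
have eig_k : eigenvalue (adjmx G) k%:R by rewrite eigE !inE eqxx.
have eig1 : eigenvalue (adjmx G) theta1 by rewrite eigE !inE eqxx !orbT.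
have eig2 : eigenvalue (adjmx G) theta2 by rewrite eigE !inE eqxx !orbT.
have eig3 : eigenvalue (adjmx G) theta3 by rewrite eigE !inE eqxx !orbT.
have lt2k := lt_trans lt2 lt1; have lt3k := lt_trans lt3 lt2k.
have pow t : eigenvalue (adjmx G) t -> t < k%:R -> t ^+ l = a + b * t.
  move=> eigt ltk; apply: (adjmx_eigenvalue_pow valG eqA eigt).
  by rewrite (lt_eqF ltk).
(* If k = 0, the eigenvalue bound gives theta1 = 0 = k. *)
have k_gt0 : 0 < k%:R :> algC.
  rewrite lt_def ler0n andbT; apply/eqP => k0.
  have := adjmx_eigenvalue_le valG eig1; rewrite k0 normr_le0 => /eqP t0.
  by move: lt1; rewrite k0 t0 ltxx.
have k_neq0 := lt0r_neq0 k_gt0.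
have two_neq0 : 2 != 0 :> algC by rewrite pnatr_eq0.
have theta3_ge : - k%:R <= theta3.
  have R3 : theta3 \is Num.real by rewrite (ler_real (ltW lt3k)) realn.
  have := adjmx_eigenvalue_le valG eig3.
  by rewrite real_ler_norml // => /andP[].
have [P [d [Pu Ad]]] := adjmx_spectral G.
have [trA trA2] := mxtrace_diag_form Pu Ad.
have ds i : d 0 i \in [:: k%:R; theta1; theta2; theta3].
  by rewrite -eigE (eigenvalue_diag _ Pu Ad); apply/existsP; exists i.
pose m z := #|[set i | d 0 i == z]|.
have m_gt0 z : eigenvalue (adjmx G) z -> (0 < m z)%N.
  rewrite (eigenvalue_diag _ Pu Ad) => /existsP[i di].
  by apply/card_gt0P; exists i; rewrite inE.
have sum_f f := sum_diag_eigenvalues f us ds.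
have AM : adjmx G = map_mx ratr
    (\matrix_(i, j) (edge (enum_val i) (enum_val j))%:R : 'M[rat]_#|G|).
  by apply/matrixP => i j; rewrite !mxE rmorph_nat.
have [q qE] := prod_eigenvalues_rat AM Pu Ad us eigA.
have [c3 c2 c1] := coef_prod4 k%:R theta1 theta2 theta3.
have coefQ i : (\prod_(z <- [:: k%:R; theta1; theta2; theta3]) ('X - z%:P))`_i
    \in Crat by rewrite qE coef_map Crat_rat.
have kQ : k%:R \in Crat by rewrite rpred_nat.
(* The coefficients of the rational quartic, with the rational root k peeled off, give the three
   elementary symmetric functions of the thetas in turn. *)
have s1Q : theta1 + theta2 + theta3 \in Crat.
  have := coefQ 3; rewrite c3 rpredN => /rpredB/(_ kQ).
  by rewrite (_ : _ - _ = theta1 + theta2 + theta3) //; ring.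
have s2Q : theta1 * theta2 + theta1 * theta3 + theta2 * theta3 \in Crat.
  have /rpredB/(_ (rpredM kQ s1Q)) := coefQ 2; rewrite c2.
  rewrite (_ : _ - _ = theta1 * theta2 + theta1 * theta3 + theta2 * theta3) //.
  by ring.
have s3Q : theta1 * theta2 * theta3 \in Crat.
  have := coefQ 1; rewrite c1 rpredN => /rpredB/(_ (rpredM kQ s2Q)).
  by rewrite (_ : _ - _ = theta1 * theta2 * theta3) //; ring.
pose x t := 2 * t / k%:R : algC.
have I1 := algebraic_integer_Aint int1.
have I2 := algebraic_integer_Aint int2.
have I3 := algebraic_integer_Aint int3.
rewrite -/(x theta1) -/(x theta2) -/(x theta3) in I1 I2 I3.
have AintM u v : u \in Aint -> v \in Aint -> u * v \in Aint.
  by move=> uI vI; rewrite rpredM.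
have hQ : 2 / k%:R \in Crat by rewrite rpred_div // rpred_nat.
have [e1 E1] : exists e : int, x theta1 + x theta2 + x theta3 = e%:~R.
  apply: Crat_Aint_intr; last by rewrite !rpredD.
  rewrite (_ : _ + x theta3 = (2 / k%:R) * (theta1 + theta2 + theta3)).
    by rewrite rpredM.
  by rewrite /x; ring.
have [e2 E2] : exists e : int, x theta1 * x theta2 + x theta1 * x theta3
    + x theta2 * x theta3 = e%:~R.
  apply: Crat_Aint_intr; last by rewrite !rpredD //; exact: AintM.
  rewrite (_ : _ + _ = (2 / k%:R) ^+ 2 *
    (theta1 * theta2 + theta1 * theta3 + theta2 * theta3)).
    by rewrite rpredM // rpredX.
  by rewrite /x; field.
have [e3 E3] : exists e : int, x theta1 * x theta2 * x theta3 = e%:~R.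
  apply: Crat_Aint_intr; last exact: (AintM _ _ (AintM _ _ I1 I2) I3).
  rewrite (_ : _ * x theta3 = (2 / k%:R) ^+ 3 * (theta1 * theta2 * theta3)).
    by rewrite rpredM // rpredX.
  by rewrite /x; field.
have xE t : x t = 2 / k%:R * t by rewrite /x mulrAC.
have x_lt t u : t < u -> x t < x u.
  by move=> tu; rewrite /x ltr_pM2r ?invr_gt0 // ltr_pM2l.
have [||||||||||| X1 X2 X3] := @scaled_spectrum_eq l k
  (x theta1) (x theta2) (x theta3) e1 e2 e3
  (m k%:R) (m theta1) (m theta2) (m theta3) l2 _ _ _ _ _ E1 E2 E3.
- exact: x_lt.
- exact: x_lt.
- by rewrite /x ltr_pdivrMr // ltr_pM2l.
- by rewrite /x ler_pdivlMr // mulNr -mulrN ler_pM2l.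
- have E : (theta1 - theta2) * theta3 ^+ l + (theta2 - theta3) * theta1 ^+ l
      = (theta1 - theta3) * theta2 ^+ l by rewrite !pow //; ring.
  rewrite !xE; move: (2 / k%:R) => h; rewrite !exprMn.
  transitivity (h * h ^+ l *
      ((theta1 - theta2) * theta3 ^+ l + (theta2 - theta3) * theta1 ^+ l)).
    by ring.
  by rewrite E; ring.
- exact: m_gt0.
- exact: m_gt0.
- exact: m_gt0.
- exact: m_gt0.
- have := sum_f id; rewrite -trA mxtrace_adjmx !big_cons big_nil addr0 => S.
  by rewrite !xE -[RHS](mulr0 (2 / k%:R)) S; field.
(* The multiplicities add up to n = [#|G|]; tr A^2 = n k, multiplied by 4 / k, is the required
   relation. *)
- have := sum_f (fun z => z ^+ 2).
  rewrite -trA2 (mxtrace_adjmx_sqr valG) !big_cons big_nil addr0 => S2.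
  have := sum_f (fun=> 1); rewrite sumr_const card_ord !big_cons big_nil addr0.
  rewrite !mulr1 => S0; rewrite !addrA in S0; rewrite -S0.
  transitivity ((4 : algC) / k%:R * (#|G|%:R * k%:R)); last by field.
  by rewrite S2 !xE; field.
have unx t z : x t = z -> t = k%:R / 2 * z by move=> <-; rewrite /x; field.
by rewrite (unx _ _ X1) (unx _ _ X2) (unx _ _ X3) mulr1 mulr0 mulrN1.
Qed.
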